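(* Let $w$ be a lower Christoffel word over $\{a,b\}$ and let $\tilde w$ be the corresponding upper Christoffel word (the reversal of $w$). Let $S_w\subseteq\mathbb Z^2$ be the set of integer points lying on the lattice paths associated with $w$ and with $\tilde w$. Then $S_w$ equals the support $\{(i,j)\in\mathbb N^2:\delta_w(i,j)>0\}$ of $\delta_w$.
   Context: Words are finite words over $\{a,b\}$; a factor of $w$ is a contiguous subword (including the empty word and $w$ itself). The Parikh image of $x$ is $(|x|_a,|x|_b)$, and $\delta_w(i,j)$ is the number of distinct factors of $w$ with Parikh image $(i,j)$. A palindrome is a word equal to its reversal. A lower Christoffel word is $a$, $b$, or a word of the form $amb$ where $m$ is a palindrome and $amb$ is a product of two palindromes; the corresponding upper Christoffel word is its reversal $\tilde w$ (so $bma$ when $w=amb$). With each word $x$ one associates the lattice path in the plane starting at the origin in which each letter $a$ is a unit step East and each letter $b$ a unit step North; the integer points on this path are exactly the points $(|y|_a,|y|_b)$ for $y$ ranging over the prefixes of $x$. *)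

(* Defs.v *)
From mathcomp Require Import all_boot all_order all_algebra.

Set Implicit Arguments.
Unset Strict Implicit.
Unset Printing Implicit Defensive.

Import GRing.Theory.

(* Words over the two-letter alphabet {a, b}, encoded by booleans. *)
Definition letter : eqType := bool.
Definition la : letter := false.
Definition lb : letter := true.
Definition word := seq letter.

Definition parikh (x : word) : nat * nat := (count_mem la x, count_mem lb x).

Definition factors (w : word) : seq word :=
  undup [seq take k (drop i w) | i <- iota 0 (size w).+1,
                                 k <- iota 0 (size w).+1].

Lemma mem_factors (w u : word) : (u \in factors w) = infix u w.
Proof.
rewrite mem_undup; apply/allpairsP/infixP => [[[i k] /= [_ _ ->]]|[p [s ->]]].
  by exists (take i w), (drop k (drop i w)); rewrite cat_take_drop cat_take_drop.
exists (size p, size u); split; rewrite ?[_ \in _]mem_iota /= ?add0n ?ltnS.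
- by rewrite size_cat leq_addr.
- by rewrite !size_cat addnCA leq_addr.
- by rewrite drop_size_cat // take_size_cat.
Qed.

Definition delta (w : word) (i j : nat) : nat :=
  count (fun u => parikh u == (i, j)) (factors w).

Definition palindrome (x : word) : Prop := rev x = x.

(* The two palindromic factors below may be empty; this is harmless, since a
   word starting with a and ending with b is not itself a palindrome. *)
Definition lower_christoffel (w : word) : Prop :=
  [\/ w = [:: la], w = [:: lb]
    | exists m : word,
        [/\ w = la :: rcons m lb,
            palindrome m
          & exists u v : word, [/\ w = u ++ v, palindrome u & palindrome v]]].

Definition upper_christoffel_of (w : word) : word := rev w.

Definition step (p : int * int) (c : letter) : int * int :=
  if c == la then (p.1 + 1, p.2)%R else (p.1, p.2 + 1)%R.

(* All steps being axis-parallel unit steps, the integer points on the plane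
   curve are the successive vertices listed here, starting at the origin. *)
Definition lattice_path (x : word) : seq (int * int) :=
  (0, 0)%R :: scanl step (0, 0)%R x.

Lemma lattice_pathP (x : word) (p : int * int) :
  reflect (exists2 y : word, prefix y x &
             p = ((parikh y).1%:Z, (parikh y).2%:Z)%R)
          (p \in lattice_path x).
Proof.
have E y q : foldl step q y = (q.1 + (parikh y).1%:Z, q.2 + (parikh y).2%:Z)%R.
  elim: y q => [|c y IH] q /=; first by rewrite !addr0; case: q.
  by rewrite IH /step; case: c => /=; rewrite ?add0n ?add1n -?addrA.
have M q : (p \in q :: scanl step q x) <->
    exists2 y, prefix y x & p = foldl step q y.
  elim: x q => [|c x IH] q.
    rewrite /= inE; split=> [/eqP ->|[[|//] _ ->]]; first by exists [::].
    by rewrite eqxx.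
  rewrite inE; split=> [/orP[/eqP ->|]|[[|d y]]].
  - by exists [::].
  - by move=> /IH [y yx ->]; exists (c :: y); rewrite //= eqxx.
  - by move=> _ ->; rewrite eqxx.
  - rewrite /= => /andP[/eqP -> yx] pE; apply/orP; right.
    by apply/(IH (step q c)); exists y.
apply: (iffP idP) => [/M [y yx ->]|[y yx pE]].
  by exists y; rewrite // E /= !add0r.
by apply/M; exists y; rewrite // pE E /= !add0r.
Qed.

Definition path_points (w : word) : pred (int * int) :=
  fun p => (p \in lattice_path w)
        || (p \in lattice_path (upper_christoffel_of w)).

Definition delta_support (w : word) (p : int * int) : Prop :=
  exists i j : nat, p = (i%:Z, j%:Z)%R /\ 0 < delta w i j.

(* Main.v *)
Require Import Defs.
From mathcomp Require Import all_boot all_order all_algebra.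
From mathcomp Require Import zify.

(** Index the letters of w = amb = uv cyclically modulo n = |w|, and let d = |u|.
    Composing the reflection that fixes u and v with the one that fixes m shows
    that shifting by d preserves all letters but the first and the last one,
    which are exchanged.  Hence the number of b's in a cyclic window of length
    k is preserved by the shift unless the window starts or ends at the
    boundary of w.  As the orbit of 0 must meet n - 1 to recover the letter a,
    d generates Z/n; so every window can be shifted, without changing its
    content, to one that is the prefix or the suffix of length k of w. *)

Definition window (f : nat -> bool) (k i : nat) : nat := \sum_(x < k) f (i + x).

Lemma window_addn (f : nat -> bool) (i k : nat) :
  window f (i + k) 0 = window f i 0 + window f k i.
Proof. by rewrite /window big_split_ord. Qed.

Lemma window_recr (f : nat -> bool) (k i : nat) :
  window f k.+1 i = window f k i + f (i + k).
Proof. by rewrite /window big_ord_recr. Qed.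

Lemma periodic_modn (f : nat -> bool) (n : nat) :
  (forall i, f (i + n) = f i) -> forall i j, i = j %[mod n] -> f i = f j.
Proof.
move=> fn; have fM q i : f (q * n + i) = f i.
  by elim: q => [|q IH]; rewrite ?mul0n // mulSn -addnA addnC fn.
by move=> i j ij; rewrite (divn_eq i n) (divn_eq j n) !fM ij.
Qed.

Lemma window_modn (f : nat -> bool) (n : nat) :
  (forall i, f (i + n) = f i) ->
  forall k i j, i = j %[mod n] -> window f k i = window f k j.
Proof.
move=> fn k i j ij; apply: eq_bigr => x _; congr nat_of_bool.
by apply: (@periodic_modn f n) => //; apply/eqP; rewrite eqn_modDr; apply/eqP.
Qed.

(** Restates the loss at the letter position [N] as a condition on the end [x.+1] of a prefix. *)
Lemma modn_eq_pred (x N : nat) : (x %% N.+1 == N) = (x.+1 %% N.+1 == 0).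
Proof.
rewrite -[x.+1]addn1 -modnDml addn1; have := ltn_pmod x (ltn0Sn N).
move: (x %% N.+1) => r; rewrite ltnS leq_eqVlt => /orP[/eqP ->|rN].
  by rewrite modnn !eqxx.
by rewrite modn_small // ltn_eqF.
Qed.

Section Reflections.

Context (f : nat -> bool) (N d : nat).
Hypothesis fn : forall i, f (i + N.+1) = f i.
Hypothesis f0 : f 0 = false.
Hypothesis fN : f N = true.
Hypothesis reflect_inner : forall i, 0 < i < N -> f (N - i) = f i.
(** With [d] the length of [u], one formula covers both palindromes: it reverses the positions of
    [v], and it sends those of [u] to their mirror images plus one period. *)
Hypothesis reflect_pal : forall i, i <= N -> f (N + d - i) = f i.

Lemma last_gt0 : 0 < N.
Proof. by rewrite lt0n; apply/eqP => N0; move: fN; rewrite N0 f0. Qed.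

(** At 0 an a becomes b, at [N] a b becomes a. Both corrections are added, on opposite sides, to
    avoid truncated subtraction. *)
Lemma shift_letter i : f (i + d) + (i %% N.+1 == N) = f i + (i %% N.+1 == 0).
Proof.
have N0 := last_gt0.
have mod_i : i %% N.+1 = i %[mod N.+1] by rewrite modn_mod.
rewrite -(periodic_modn _ _ fn _ _ mod_i) -(periodic_modn _ _ fn (i %% N.+1 + d)).
  have : i %% N.+1 <= N by rewrite -ltnS ltn_pmod.
  move: (i %% N.+1) => r rN.
  have [->|r0] := eqVneq r 0.
    by rewrite add0n f0 -[d](addKn N) reflect_pal // fN; lia.
  have [->|rN'] := eqVneq r N; first by rewrite -[N + d]subn0 reflect_pal // f0 fN.
  (* The shift is the reflection of [m] followed by that of [u] and [v]. *)
  have -> : r + d = N + d - (N - r) by lia.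
  by rewrite reflect_pal ?leq_subr // reflect_inner; lia.
by rewrite modnDml.
Qed.

(** A b gained at a multiple of [N.+1] is lost at the next position congruent to [N], so the excess
    is 1 strictly between multiples. *)
Lemma shift_prefix x :
  window f (x + d) 0 = window f x 0 + window f d 0 + (x %% N.+1 != 0).
Proof.
elim: x => [|x IH]; first by rewrite /window big_ord0 mod0n !add0n addn0.
have := shift_letter x; rewrite addSn !window_recr IH !add0n modn_eq_pred.
by case: (_.+1 %% _ == 0); case: (x %% _ == 0) => /=; lia.
Qed.

(** The window is a difference of two prefixes, both with excess 1, which cancels. *)
Lemma shift_window k i : i %% N.+1 != 0 -> (i + k) %% N.+1 != 0 ->
  window f k (i + d) = window f k i.
Proof.
move=> i0 ik0.
have := shift_prefix (i + k); have := shift_prefix i.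
rewrite i0 ik0 (addnAC i k d) !window_addn; lia.
Qed.

(** The first shift from 0 produces a b. If it were never lost, it would persist up to [N.+1 * d],
    which is congruent to 0 and carries an a. *)
Lemma orbit_meets_last : exists j, j * d = N %[mod N.+1].
Proof.
have [/existsP[j /eqP jN]|nex] := boolP [exists j : 'I_N.+1, j * d %% N.+1 == N].
  by exists j; rewrite jN modn_small.
have orbitT j : j <= N -> f (j.+1 * d).
  elim: j => [_|j IH jN].
    have := shift_letter 0; rewrite mul1n add0n mod0n f0 ltn_eqF ?last_gt0 //.
    by case: (f d).
  have := shift_letter (j.+1 * d); rewrite IH ?(ltnW jN) // [j.+2 * d]mulSnr.
  (* Only at [N] can the shift turn a b into an a. *)
  case: eqP => [jdN|_]; last by case: (f _) => //; lia.
  by case/existsP: nex; exists (Ordinal (jN : j.+1 < N.+1)); apply/eqP.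
have := orbitT N (leqnn N); rewrite (periodic_modn _ _ fn _ 0) ?f0 //.
by rewrite mod0n modnMr.
Qed.

Lemma window_prefix_or_suffix k i : k <= N.+1 ->
  window f k i = window f k 0 \/ window f k i = window f k (N.+1 - k).
Proof.
move=> kN; have [j jd] := orbit_meets_last.
pose P i := window f k i = window f k 0 \/ window f k i = window f k (N.+1 - k).
have Pmod x y : x = y %[mod N.+1] -> P x -> P y.
  by move=> xy; rewrite /P (window_modn _ _ fn k x y xy).
have Pshift x : P (x + d) -> P x.
  (* Where the shift may change the count, the window already is the prefix or the suffix. *)
  have [x0 _|x0] := eqVneq (x %% N.+1) 0.
    by left; apply: (window_modn _ _ fn); rewrite x0 mod0n.
  have [xk _|xk] := eqVneq ((x + k) %% N.+1) 0; last by rewrite /P shift_window.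
  right; apply: (window_modn _ _ fn); apply/eqP.
  by rewrite -(eqn_modDr k) subnK // modnn xk.
have Piter t x : P (x + t * d) -> P x.
  elim: t => [|t IH]; first by rewrite mul0n addn0.
  by rewrite mulSnr addnA => /Pshift.
(* Since [j * d] is congruent to -1, [i * j] shifts bring [i] to 0. *)
apply: (Piter (i * j)); apply: (Pmod 0); last by left.
rewrite -mulnA -modnDmr -modnMmr jd modnMmr modnDmr mod0n.
by rewrite -mulnS modnMl.
Qed.

End Reflections.

Lemma count_mem_nth (s : word) :
  count_mem lb s = \sum_(i < size s) (nth la s i : bool).
Proof.
elim: s => [|c s IH] /=; first by rewrite big_ord0.
by rewrite big_ord_recl /= IH; case: c.
Qed.

(** For words of equal length, it thus suffices to compare the numbers of b's. *)
Lemma parikhE (x : word) : parikh x = (size x - count_mem lb x, count_mem lb x).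
Proof.
congr pair; rewrite -(count_predC (pred1 lb) x) addKn.
by apply: eq_count => -[].
Qed.

Lemma parikh_rev (x : word) : parikh (rev x) = parikh x.
Proof. by rewrite /parikh !count_rev. Qed.

Definition cyclic_nth (w : word) (i : nat) : bool := nth la w (i %% size w).

Lemma count_take_drop (w : word) (i k : nat) : i + k <= size w ->
  count_mem lb (take k (drop i w)) = window (cyclic_nth w) k i.
Proof.
move=> ik; rewrite count_mem_nth size_takel ?size_drop; last lia.
apply: eq_bigr => x _; rewrite nth_take // nth_drop /cyclic_nth modn_small //.
by have := ltn_ord x; lia.
Qed.

Lemma palindrome_nth (x : word) (i : nat) : palindrome x -> i < size x ->
  nth la x (size x - i.+1) = nth la x i.
Proof. by move=> px ix; rewrite -nth_rev // (px : rev x = x). Qed.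

Lemma christoffel_window (w : word) (i k : nat) :
  lower_christoffel w -> i + k <= size w ->
  window (cyclic_nth w) k i = window (cyclic_nth w) k 0 \/
  window (cyclic_nth w) k i = window (cyclic_nth w) k (size w - k).
Proof.
have singleton c : window (cyclic_nth [:: c]) k i = window (cyclic_nth [:: c]) k 0.
  by apply: eq_bigr => x _; rewrite /cyclic_nth !modn1.
case=> [->|->|[m [wE pm [u [v [wuv pu pv]]]]]] ik; [by left|by left|].
have [[M sm] [U su] [V sv]] :
    [/\ exists M, size m = M, exists U, size u = U & exists V, size v = V].
  by split; eexists.
have sw : size w = M.+2 by rewrite wE /= size_rcons sm.
have UV : M.+2 = U + V by rewrite -sw wuv size_cat su sv.
(* Here [N] is [M.+1] and the shift is [U], the length of [u]. *)
rewrite sw in ik *; apply: (@window_prefix_or_suffix _ _ U); last lia.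
- by move=> x; rewrite /cyclic_nth sw modnDr.
- by rewrite /cyclic_nth mod0n wE.
- by rewrite /cyclic_nth sw modn_small // wE /= nth_rcons sm ltnn eqxx.
- case=> [//|x] /= xm.
  rewrite /cyclic_nth sw !modn_small; try lia.
  have -> : M.+1 - x.+1 = (M - x.+1).+1 by lia.
  have [xM xM'] : M - x.+1 < M /\ x < M by lia.
  by rewrite wE /= !nth_rcons sm xM xM' -sm palindrome_nth // sm.
move=> x xm; rewrite /cyclic_nth sw [x %% _]modn_small; last lia.
have [xu|ux] := ltnP x U.
  (* Inside [u] the mirror image appears one period further. *)
  have -> : M.+1 + U - x = U - x.+1 + M.+2 by lia.
  have xu' : U - x.+1 < U by lia.
  rewrite modnDr modn_small; last lia.
  by rewrite wuv !nth_cat su xu xu' -su palindrome_nth // su.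
have nxu : (M.+1 + U - x < U) = false by lia.
rewrite modn_small; last lia.
rewrite wuv !nth_cat su nxu ltnNge ux /=.
(* Inside [v], positions are counted from [U] and no wrap-around occurs. *)
have -> : M.+1 + U - x - U = V - (x - U).+1 by lia.
by rewrite -sv palindrome_nth // sv; lia.
Qed.

Lemma delta_gt0 (w : word) (i j : nat) :
  0 < delta w i j <-> exists2 x, infix x w & parikh x = (i, j).
Proof.
rewrite /delta -has_count; split=> [/hasP[x]|[x xw xij]].
  by rewrite mem_factors => xw /eqP xij; exists x.
by apply/hasP; exists x; rewrite ?mem_factors ?xij.
Qed.

Theorem theorem5 (w : word) (hw : lower_christoffel w) :
  forall p : int * int, p \in path_points w <-> delta_support w p.
Proof.
move=> p; split=> [/orP[]/lattice_pathP[y yw ->]|[i [j [-> /delta_gt0[x]]]]].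
- exists (parikh y).1, (parikh y).2; split=> //.
  by apply/delta_gt0; exists y; [apply: prefixW | case: (parikh y)].
- exists (parikh y).1, (parikh y).2; split=> //.
  (* A prefix of the upper word is a reversed suffix of [w]. *)
  apply/delta_gt0; exists (rev y); last by rewrite parikh_rev; case: (parikh y).
  by apply: suffixW; rewrite -prefix_rev revK.
case/infixP=> [s [t wE]] xij.
have szw : size w = size s + (size x + size t) by rewrite wE !size_cat.
have xE : x = take (size x) (drop (size s) w).
  by rewrite wE drop_size_cat // take_size_cat.
have sx : size s + size x <= size w by lia.
have := christoffel_window w (size s) (size x) hw sx.
rewrite -count_take_drop // -xE => -[] eq_b; apply/orP; [left|right].
- apply/lattice_pathP; exists (take (size x) w); first exact: prefix_take.
  suff -> : parikh (take (size x) w) = (i, j) by [].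
  rewrite -xij !parikhE size_takel; last lia.
  by rewrite eq_b -count_take_drop ?drop0 //; lia.
(* Conversely, the suffix of [w] of the length of [x], reversed, is a prefix of the upper word. *)
apply/lattice_pathP; exists (rev (drop (size w - size x) w)).
  by rewrite prefix_rev suffix_drop.
suff -> : parikh (rev (drop (size w - size x) w)) = (i, j) by [].
have sz_drop : size (drop (size w - size x) w) = size x by rewrite size_drop; lia.
rewrite parikh_rev -xij !parikhE sz_drop eq_b -count_take_drop; last lia.
by rewrite take_oversize ?sz_drop.
Qed.
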